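(* Consider the Kalman smoothing data and the block tridiagonal system $Cx=r$ described in the context, where $C=H^{\mathrm T}R^{-1}H+G^{\mathrm T}Q^{-1}G$ and $r=H^{\mathrm T}R^{-1}z+G^{\mathrm T}Q^{-1}\zeta$. When applied to $C$ with right-hand side $r$, the backward block tridiagonal (BBT) algorithm is equivalent to the M smoother (Mayne's Algorithm A). In particular, for every $k=1,\dots,N$, the block $d_k^b$ of the BBT algorithm corresponds to $P_k+Q_k^{-1}$, i.e. $d_k^b=P_k+Q_k^{-1}$, and $s_k^b$ of the BBT algorithm is precisely $-\phi_k$, i.e. $s_k^b=-\phi_k$, where $P_k$ and $\phi_k$ are generated by the backward recursion of the M smoother.
   Context: **Data.** $x_0\in\mathbb{R}^n$ is known; $G_k\in\mathbb{R}^{n\times n}$ ($k=2,\dots,N$), $H_k\in\mathbb{R}^{m(k)\times n}$, $z_k\in\mathbb{R}^{m(k)}$, and symmetric positive definite $Q_k\in\mathbb{R}^{n\times n}$, $R_k\in\mathbb{R}^{m(k)\times m(k)}$ ($k=1,\dots,N$). These come from the linear Gaussian model $x_1=x_0+w_1$, $x_k=G_kx_{k-1}+w_k$ ($k=2,\dots,N$), $z_k=H_kx_k+v_k$ ($k=1,\dots,N$), with $w_k,v_k$ mutually independent zero-mean Gaussian with covariances $Q_k,R_k$. **System.** $Q,R,H$ are the block diagonal matrices with diagonal blocks $Q_k,R_k,H_k$; $G$ is block lower bidiagonal with identity diagonal blocks and $-G_k$ in block position $(k,k-1)$; $z$ stacks $z_1,\dots,z_N$ and $\zeta$ stacks $x_0,0,\dots,0$.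 Then $C$ is symmetric positive definite and block tridiagonal, with diagonal blocks $b_k=Q_k^{-1}+G_{k+1}^{\mathrm T}Q_{k+1}^{-1}G_{k+1}+H_k^{\mathrm T}R_k^{-1}H_k$ (the term with index $N+1$ is zero), blocks $c_k=-Q_k^{-1}G_k$ in position $(k,k-1)$ and $c_k^{\mathrm T}$ in position $(k-1,k)$, $k=2,\dots,N$. Write $r_k$ for the blocks of $r$. **BBT algorithm.** Set $d_N^b=b_N$, $s_N^b=r_N$; for $k=N-1,\dots,1$ set $d_k^b=b_k-c_{k+1}^{\mathrm T}(d_{k+1}^b)^{-1}c_{k+1}$ and $s_k^b=r_k-c_{k+1}^{\mathrm T}(d_{k+1}^b)^{-1}s_{k+1}^b$. Then set $e_1=(d_1^b)^{-1}s_1^b$ and, for $k=2,\dots,N$, $e_k=(d_k^b)^{-1}(s_k^b-c_ke_{k-1})$. The output is $e_1,\dots,e_N$. **M smoother (Mayne, 1966, Algorithm A).** Write $Q_k=C_kC_k^{\mathrm T}$. Backward recursion: set $P_N=H_N^{\mathrm T}R_N^{-1}H_N$, $\phi_N=-H_N^{\mathrm T}R_N^{-1}z_N$, $\Delta_k=[I+C_k^{\mathrm T}P_kC_k]^{-1}$, and for $k=N-1,\dots,1$ $$P_k=G_{k+1}^{\mathrm T}\big[I-P_{k+1}C_{k+1}\Delta_{k+1}C_{k+1}^{\mathrm T}\big]P_{k+1}G_{k+1}+H_k^{\mathrm T}R_k^{-1}H_k,$$ $$\phi_k=-H_k^{\mathrm T}R_k^{-1}z_k+G_{k+1}^{\mathrm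 T}\big[I-P_{k+1}C_{k+1}\Delta_{k+1}C_{k+1}^{\mathrm T}\big]\phi_{k+1}.$$ Forward recursion for the smoothed state estimates: $\hat x_1=-(P_1+Q_1^{-1})^{-1}(\phi_1-Q_1^{-1}x_0)$ and, for $k=2,\dots,N$, $\hat x_k=-(P_k+Q_k^{-1})^{-1}(\phi_k-Q_k^{-1}G_k\hat x_{k-1})$.
   Formalization: The claim s_k^b = -φ_k fails at k = 1 when x_0 ≠ 0, since r_1 contains Q_1^{-1}x_0 and φ_1 does not; the formal theorem proves s_k^b = -φ_k for 2 ≤ k ≤ N and s_1^b = -(φ_1 - Q_1^{-1}x_0). *)

(* Defs.v *)
From mathcomp Require Import all_boot all_order all_algebra.

Set Implicit Arguments.
Unset Strict Implicit.
Unset Printing Implicit Defensive.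

Import GRing.Theory Num.Theory.
Local Open Scope ring_scope.

(* Families of stage data (G, H, Q, R, z, ...) are indexed by nat and used at
   the stages k = 1, ..., N; block number i : 'I_N of an assembled matrix is
   stage i.+1. *)

Definition posdefmx (F : realFieldType) (n : nat) (A : 'M[F]_n) : Prop :=
  A^T = A /\ forall x : 'cV[F]_n, x != 0 -> 0 < (x^T *m A *m x) 0 0.

Section System.

Variables (F : realFieldType) (N n : nat) (m : nat -> nat).

Definition Qmx (Q : nat -> 'M[F]_n) : 'M[F]_(\sum_(i < N) n) :=
  \mxdiag_(i < N) Q i.+1.

Definition Rmx (R : forall k, 'M[F]_(m k)) : 'M[F]_(\sum_(i < N) m i.+1) :=
  \mxdiag_(i < N) R i.+1.

(* The blocks of H are rectangular, so mxdiag does not apply. *)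
Definition Hmx (H : forall k, 'M[F]_(m k, n)) :
    'M[F]_(\sum_(i < N) m i.+1, \sum_(i < N) n) :=
  \mxblock_(i < N, j < N) (if i == j then H i.+1 else 0).

Definition Gmx (G : nat -> 'M[F]_n) : 'M[F]_(\sum_(i < N) n) :=
  \mxblock_(i < N, j < N)
    (if i == j then 1%:M
     else if i == j.+1 :> nat then - G i.+1
     else 0).

Definition zvec (z : forall k, 'cV[F]_(m k)) : 'cV[F]_(\sum_(i < N) m i.+1) :=
  \mxcol_(i < N) z i.+1.

Definition zetavec (x0 : 'cV[F]_n) : 'cV[F]_(\sum_(i < N) n) :=
  \mxcol_(i < N) (if i == 0%N :> nat then x0 else 0).

Definition system_mx (G : nat -> 'M[F]_n) (H : forall k, 'M[F]_(m k, n))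
    (Q : nat -> 'M[F]_n) (R : forall k, 'M[F]_(m k)) :
    'M[F]_(\sum_(i < N) n) :=
  (Hmx H)^T *m invmx (Rmx R) *m Hmx H + (Gmx G)^T *m invmx (Qmx Q) *m Gmx G.

Definition system_rhs (G : nat -> 'M[F]_n) (H : forall k, 'M[F]_(m k, n))
    (Q : nat -> 'M[F]_n) (R : forall k, 'M[F]_(m k))
    (z : forall k, 'cV[F]_(m k)) (x0 : 'cV[F]_n) : 'cV[F]_(\sum_(i < N) n) :=
  (Hmx H)^T *m invmx (Rmx R) *m zvec z
    + (Gmx G)^T *m invmx (Qmx Q) *m zetavec x0.

(* The blocks of a block matrix or vector at positions k, l in 1, ..., N;
   other positions are never read below. *)
Definition mxblk (A : 'M[F]_(\sum_(i < N) n)) (k l : nat) : 'M[F]_n :=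
  match (insub k.-1 : option 'I_N), (insub l.-1 : option 'I_N) with
  | Some i, Some j => submxblock A i j
  | _, _ => 0
  end.

Definition cvblk (v : 'cV[F]_(\sum_(i < N) n)) (k : nat) : 'cV[F]_n :=
  if (insub k.-1 : option 'I_N) is Some i then submxcol v i else 0.

End System.

(* backrec N last step is the sequence u with u N = last and
   u k = step k (u k.+1) for k < N. *)
Definition backrec (T : Type) (N : nat) (last : T) (step : nat -> T -> T)
    (k : nat) : T :=
  foldr step last (iota k (N - k)).

Lemma backrec_last (T : Type) N (last : T) step : backrec N last step N = last.
Proof. by rewrite /backrec subnn. Qed.

Lemma backrec_step (T : Type) N (last : T) step k :
  (k < N)%N -> backrec N last step k = step k (backrec N last step k.+1).
Proof. by move=> ltkN; rewrite /backrec -(subnSK ltkN). Qed.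

Section BBT.

Variables (F : realFieldType) (N n : nat).
Variables (A : 'M[F]_(\sum_(i < N) n)) (r : 'cV[F]_(\sum_(i < N) n)).

Definition bbt_b (k : nat) : 'M[F]_n := mxblk A k k.
Definition bbt_c (k : nat) : 'M[F]_n := mxblk A k k.-1.

Definition bbt_d : nat -> 'M[F]_n :=
  backrec N (bbt_b N)
    (fun k d => bbt_b k - (bbt_c k.+1)^T *m invmx d *m bbt_c k.+1).

Definition bbt_s : nat -> 'cV[F]_n :=
  backrec N (cvblk r N)
    (fun k s => cvblk r k - (bbt_c k.+1)^T *m invmx (bbt_d k.+1) *m s).

(* The stages start at 1; the value at 0 is a placeholder. *)
Fixpoint bbt_e (k : nat) : 'cV[F]_n :=
  match k with
  | 0%N => 0
  | k'.+1 =>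
      if k' == 0%N then invmx (bbt_d 1%N) *m bbt_s 1%N
      else invmx (bbt_d k) *m (bbt_s k - bbt_c k *m bbt_e k')
  end.

End BBT.

Section MSmoother.

Variables (F : realFieldType) (N n : nat) (m p : nat -> nat).
Variables (G : nat -> 'M[F]_n) (H : forall k, 'M[F]_(m k, n)).
Variables (Q : nat -> 'M[F]_n) (R : forall k, 'M[F]_(m k)).
(* C k is the chosen factor of Q k = C k *m (C k)^T. *)
Variable C : forall k, 'M[F]_(n, p k).
Variables (z : forall k, 'cV[F]_(m k)) (x0 : 'cV[F]_n).

(* The matrix whose inverse is Delta_k; P_k is passed as an argument because
   Delta_{k+1} enters the recursion that produces P_k from P_{k+1}. *)
Definition mayne_DeltaV (k : nat) (Pk : 'M[F]_n) : 'M[F]_(p k) :=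
  1%:M + (C k)^T *m Pk *m C k.

Definition mayne_Delta (k : nat) (Pk : 'M[F]_n) : 'M[F]_(p k) :=
  invmx (mayne_DeltaV k Pk).

Definition mayne_P : nat -> 'M[F]_n :=
  backrec N ((H N)^T *m invmx (R N) *m H N)
    (fun k P' =>
       (G k.+1)^T
         *m (1%:M - P' *m C k.+1 *m mayne_Delta k.+1 P' *m (C k.+1)^T)
         *m P' *m G k.+1
       + (H k)^T *m invmx (R k) *m H k).

Definition mayne_phi : nat -> 'cV[F]_n :=
  backrec N (- ((H N)^T *m invmx (R N) *m z N))
    (fun k phi' =>
       let P' := mayne_P k.+1 in
       - ((H k)^T *m invmx (R k) *m z k)
       + (G k.+1)^T
         *m (1%:M - P' *m C k.+1 *m mayne_Delta k.+1 P' *m (C k.+1)^T)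
         *m phi').

(* The stages start at 1; the value at 0 is a placeholder. *)
Fixpoint mayne_xhat (k : nat) : 'cV[F]_n :=
  match k with
  | 0%N => 0
  | k'.+1 =>
      if k' == 0%N then
        - (invmx (mayne_P 1%N + invmx (Q 1%N))
             *m (mayne_phi 1%N - invmx (Q 1%N) *m x0))
      else
        - (invmx (mayne_P k + invmx (Q k))
             *m (mayne_phi k - invmx (Q k) *m G k *m mayne_xhat k'))
  end.

End MSmoother.

(* Main.v *)
Require Import Defs.
From mathcomp Require Import all_boot all_order all_algebra.

Set Implicit Arguments.
Unset Strict Implicit.
Unset Printing Implicit Defensive.

Import Order.TTheory GRing.Theory Num.Theory.
Local Open Scope ring_scope.

(** Both algorithms run backward over the stages and forward again, so it is
    enough to match the backward quantities; the forward sweeps are then the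
    same formula up to a sign.

    Expanding the weighted products [H^T R^-1 H] and [G^T Q^-1 G] block by block
    ([bbt_bE], [bbt_cE], [cvblk_system_rhs]) turns one step of the block
    elimination into
    [d_k = Q_k^-1 + H_k^T R_k^-1 H_k
           + G_(k+1)^T (Q^-1 - Q^-1 d_(k+1)^-1 Q^-1) G_(k+1)],
    with [Q] taken at stage [k+1].  If [d_(k+1) = P + Q^-1] with [P = P_(k+1)]
    and [Q = C C^T], the matrix inversion lemma gives
    [1 - P C Delta C^T = Q^-1 (P + Q^-1)^-1] ([mayne_factorE]), and so
    [(1 - P C Delta C^T) P = Q^-1 - Q^-1 d_(k+1)^-1 Q^-1]
    ([mayne_factor_mulP]).  Hence [d_k = P_k + Q_k^-1].  The first identity also
    matches the recursion for [s] with the one for [- phi]; the known state [x0]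
    enters the right-hand side at stage 1 only.

    All inverses exist because every [P_k] is symmetric positive semidefinite:
    then [P_k + Q_k^-1] and [1 + C_k^T P_k C_k] are positive definite.
    Semidefiniteness passes from [P_(k+1)] to [P_k] by rewriting the Riccati
    term in Joseph form ([psdmx_mayne_factor_mulP]). *)

(** * Positive semidefinite matrices *)

(** Symmetry is part of the notion: over a real field the sign of the quadratic
    form does not imply it, and the identities below transpose [P]. *)
Definition psdmx (F : realFieldType) (n : nat) (A : 'M[F]_n) : Prop :=
  A^T = A /\ forall x : 'cV[F]_n, 0 <= (x^T *m A *m x) 0 0.

Section PositiveMatrices.

Variable F : realFieldType.

Lemma posdefmx_psdmx n (A : 'M[F]_n) : posdefmx A -> psdmx A.
Proof.
move=> [symA posA]; split=> // x; have [->|x_neq0] := eqVneq x 0.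
  by rewrite mulmx0 mxE.
exact/ltW/posA.
Qed.

Lemma psdmxD n (A B : 'M[F]_n) : psdmx A -> psdmx B -> psdmx (A + B).
Proof.
move=> [symA posA] [symB posB]; split=> [|x]; first by rewrite linearD /= symA symB.
by rewrite mulmxDr mulmxDl mxE addr_ge0.
Qed.

Lemma posdefmxDr n (A B : 'M[F]_n) : psdmx A -> posdefmx B -> posdefmx (A + B).
Proof.
move=> [symA posA] [symB posB]; split=> [|x x_neq0].
  by rewrite linearD /= symA symB.
by rewrite mulmxDr mulmxDl mxE ltr_wpDl ?posB.
Qed.

Lemma psdmx_congr n p (A : 'M[F]_n) (B : 'M[F]_(n, p)) :
  psdmx A -> psdmx (B^T *m A *m B).
Proof.
move=> [symA posA]; split=> [|x]; first by rewrite !trmx_mul trmxK symA !mulmxA.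
by have := posA (B *m x); rewrite trmx_mul !mulmxA.
Qed.

Lemma posdefmx1 n : posdefmx (1%:M : 'M[F]_n).
Proof.
split=> [|x x_neq0]; first by rewrite trmx1.
rewrite mulmx1 mxE lt_def sumr_ge0 ?andbT => [|i _]; last first.
  by rewrite mxE -expr2 sqr_ge0.
apply: contra x_neq0; rewrite psumr_eq0 => [/allP x0|i _]; last first.
  by rewrite mxE -expr2 sqr_ge0.
apply/eqP/colP => i; have := x0 i (mem_index_enum i).
by rewrite !mxE -expr2 sqrf_eq0 => /eqP.
Qed.

(** A nonzero row vector killed by [A] would transpose to a nonzero zero of the
    quadratic form. *)
Lemma posdefmx_unit n (A : 'M[F]_n) : posdefmx A -> A \in unitmx.
Proof.
move=> [_ posA]; rewrite -row_free_unit; apply: inj_row_free => v vA0.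
apply/eqP; apply/negPn/negP => v_neq0.
have := posA v^T; rewrite trmx_eq0 => /(_ v_neq0).
by rewrite trmxK vA0 mul0mx mxE ltxx.
Qed.

Lemma posdefmx_inv n (A : 'M[F]_n) : posdefmx A -> posdefmx (invmx A).
Proof.
move=> pdA; have uA := posdefmx_unit pdA; have [symA posA] := pdA.
split=> [|x x_neq0]; first by rewrite trmx_inv symA.
have -> : x^T *m invmx A *m x = (invmx A *m x)^T *m A *m (invmx A *m x).
  by rewrite trmx_mul trmx_inv symA !mulmxA mulmxKV.
by apply: posA; apply: contra x_neq0 => /eqP ix0; rewrite -(mulKVmx uA x) ix0 mulmx0.
Qed.

End PositiveMatrices.

(** * One step of Mayne's recursion *)

(** Here [P] and [Q] stand for [P_(k+1)] and [Q_(k+1)], and [D] is the value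
    that the block elimination reaches at that stage. *)
Section RiccatiStep.

Variables (F : realFieldType) (n p : nat).
Variables (Q P : 'M[F]_n) (C : 'M[F]_(n, p)).
Hypotheses (Q_posdef : posdefmx Q) (Q_factor : Q = C *m C^T) (P_psd : psdmx P).

Let Delta := invmx (1%:M + C^T *m P *m C).
Let D := P + invmx Q.

Lemma posdefmx_mayne_DeltaV : posdefmx (1%:M + C^T *m P *m C).
Proof. by rewrite addrC; apply/posdefmxDr/posdefmx1/psdmx_congr. Qed.

Lemma posdefmx_mayne_D : posdefmx D.
Proof. exact/posdefmxDr/posdefmx_inv. Qed.

(** Matrix inversion lemma: since [D Q = 1 + P C C^T], multiplying Mayne's
    factor by [D Q] collapses to the identity after pulling [C^T] through
    [1 + P C C^T]. *)
Lemma mayne_factorE :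
  1%:M - P *m C *m Delta *m C^T = invmx Q *m invmx D.
Proof.
have uQ := posdefmx_unit Q_posdef; have uD := posdefmx_unit posdefmx_mayne_D.
have uV := posdefmx_unit posdefmx_mayne_DeltaV.
have DQ : D *m Q = 1%:M + P *m C *m C^T.
  by rewrite mulmxDl mulVmx // addrC Q_factor mulmxA.
have push : C^T *m (D *m Q) = (1%:M + C^T *m P *m C) *m C^T.
  by rewrite DQ mulmxDr mulmxDl mulmx1 mul1mx !mulmxA.
have K1 : (1%:M - P *m C *m Delta *m C^T) *m (D *m Q) = 1%:M.
  rewrite mulmxBl mul1mx -(mulmxA _ C^T) push -(mulmxA _ Delta) /Delta.
  by rewrite mulKmx // DQ addrK.
rewrite mulmxA in K1.
by rewrite -[LHS](mulmxK uD) -[X in X *m invmx D = _](mulmxK uQ) K1 mul1mx.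
Qed.

(** This is the Schur-complement term that the block elimination produces,
    written with [invmx Q] in place of the factor [C]. *)
Lemma mayne_factor_mulP :
  (1%:M - P *m C *m Delta *m C^T) *m P
    = invmx Q - invmx Q *m invmx D *m invmx Q.
Proof.
rewrite mayne_factorE -[X in _ *m X = _](addrK (invmx Q)) mulmxBr mulmxKV //.
exact/posdefmx_unit/posdefmx_mayne_D.
Qed.

(** Joseph form: with [K = Q^-1 D^-1] one has [K (1 + P Q) = 1], hence
    [K P = K (P + P Q P) K^T], which is semidefinite although [K P] is not
    visibly so. *)
Lemma psdmx_mayne_factor_mulP :
  psdmx ((1%:M - P *m C *m Delta *m C^T) *m P).
Proof.
have uQ := posdefmx_unit Q_posdef; have uD := posdefmx_unit posdefmx_mayne_D.
have [symQ _] := Q_posdef; have [symP _] := P_psd.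
have [symD _] := posdefmx_mayne_D.
have QDK : (1%:M + Q *m P) *m (invmx D *m invmx Q) = 1%:M.
  have -> : 1%:M + Q *m P = Q *m D by rewrite mulmxDr mulmxV // addrC.
  by rewrite mulmxA mulmxK // mulmxV.
have -> : (1%:M - P *m C *m Delta *m C^T) *m P
    = (invmx D *m invmx Q)^T *m (P + P^T *m Q *m P) *m (invmx D *m invmx Q).
  have -> : P + P^T *m Q *m P = P *m (1%:M + Q *m P).
    by rewrite symP mulmxDr mulmx1 mulmxA.
  by rewrite mayne_factorE -!mulmxA QDK mulmx1 trmx_mul !trmx_inv symQ symD mulmxA.
by apply/psdmx_congr/psdmxD => //; apply/psdmx_congr/posdefmx_psdmx.
Qed.

End RiccatiStep.

(** * Blocks of the smoothing system *)

Section WeightedProducts.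

Variables (F : fieldType) (N q : nat) (m_ : 'I_N -> nat) (n_ : 'I_q -> nat).
Variable D : forall i, 'M[F]_(m_ i).

Lemma invmx_mxdiag : (forall i, D i \in unitmx) ->
  invmx (\mxdiag_i D i) = \mxdiag_i invmx (D i).
Proof.
move=> uD; have DV : \mxdiag_i D i *m \mxdiag_i invmx (D i) = 1%:M.
  rewrite {2}/mxdiag mul_mxdiag_mxblock -mxdiagZ /mxdiag.
  apply/eq_mxblock => i j; case: eqVneq => [{j}<-|_].
    by rewrite !conform_mx_id mulmxV.
  by rewrite mulmx0.
have [uM _] := mulmx1_unit DV.
by rewrite -[RHS](mulKmx uM) DV mulmx1.
Qed.

Lemma mxblock_wgram (X : forall i j, 'M[F]_(m_ i, n_ j)) :
  (\mxblock_(i, j) X i j)^T *m \mxdiag_i D i *m \mxblock_(i, j) X i j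
    = \mxblock_(i, j) \sum_k (X k i)^T *m D k *m X k j.
Proof. by rewrite tr_mxblock mul_mxblock_mxdiag mul_mxblock. Qed.

Lemma mxblock_wrhs (X : forall i j, 'M[F]_(m_ i, n_ j))
    (Y : forall i, 'cV[F]_(m_ i)) :
  (\mxblock_(i, j) X i j)^T *m \mxdiag_i D i *m \mxcol_i Y i
    = \mxcol_i \sum_k (X k i)^T *m D k *m Y k.
Proof. by rewrite tr_mxblock mul_mxblock_mxdiag mul_mxblock_mxrow. Qed.

End WeightedProducts.

Section SystemBlocks.

Variables (F : realFieldType) (N n : nat) (m : nat -> nat).
Variables (G : nat -> 'M[F]_n) (H : forall k, 'M[F]_(m k, n)).
Variables (Q : nat -> 'M[F]_n) (R : forall k, 'M[F]_(m k)).
Variables (z : forall k, 'cV[F]_(m k)) (x0 : 'cV[F]_n).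
Hypothesis Q_unit : forall k, (1 <= k <= N)%N -> Q k \in unitmx.
Hypothesis R_unit : forall k, (1 <= k <= N)%N -> R k \in unitmx.

Let A := system_mx N G H Q R.
Let r := system_rhs N G H Q R z x0.

Let Hblk (i j : 'I_N) : 'M[F]_(m i.+1, n) := if i == j then H i.+1 else 0.
Let Gblk (i j : 'I_N) : 'M[F]_n :=
  if i == j then 1%:M else if i == j.+1 :> nat then - G i.+1 else 0.

Lemma submxblock_system_mx i j :
  submxblock A i j
    = \sum_k (Hblk k i)^T *m invmx (R k.+1) *m Hblk k j
      + \sum_k (Gblk k i)^T *m invmx (Q k.+1) *m Gblk k j.
Proof.
rewrite /A /system_mx /Hmx /Gmx /Rmx /Qmx.
rewrite !invmx_mxdiag;
  [|by move=> l; rewrite Q_unit /=|by move=> l; rewrite R_unit /=].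
by rewrite !mxblock_wgram -mxblockD mxblockK.
Qed.

Lemma submxcol_system_rhs i :
  submxcol r i
    = \sum_k (Hblk k i)^T *m invmx (R k.+1) *m z k.+1
      + \sum_k (Gblk k i)^T *m invmx (Q k.+1)
                 *m (if k == 0%N :> nat then x0 else 0).
Proof.
rewrite /r /system_rhs /Hmx /Gmx /Rmx /Qmx /zvec /zetavec.
rewrite !invmx_mxdiag;
  [|by move=> l; rewrite Q_unit /=|by move=> l; rewrite R_unit /=].
by rewrite !mxblock_wrhs -mxcolD mxcolK.
Qed.

Lemma insub_stage (i : 'I_N) : insub i.+1.-1 = Some i.
Proof. by rewrite /= valK. Qed.

Lemma sum_Hblk p (i : 'I_N) (X : forall k : 'I_N, 'M[F]_(m k.+1, p)) :
  \sum_k (Hblk k i)^T *m invmx (R k.+1) *m X k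
    = (H i.+1)^T *m invmx (R i.+1) *m X i.
Proof.
rewrite (bigD1 i) //= /Hblk eqxx big1 ?addr0 // => k /negPf->.
by rewrite trmx0 !mul0mx.
Qed.

Lemma bbt_bE k : (0 < k <= N)%N ->
  bbt_b A k = (H k)^T *m invmx (R k) *m H k + invmx (Q k)
              + (if (k < N)%N then (G k.+1)^T *m invmx (Q k.+1) *m G k.+1
                 else 0).
Proof.
case: k => // k /= ltkN; pose i := Ordinal ltkN.
rewrite /bbt_b /mxblk (insub_stage i) submxblock_system_mx sum_Hblk -addrA.
rewrite {1}/Hblk eqxx; congr (_ + _).
rewrite (bigD1 i) //= {1 2}/Gblk eqxx trmx1 mulmx1 mul1mx; congr (_ + _).
(* Only the next block row of G meets column k off the diagonal. *)
case: ifP => [ltSkN | /negbT geSkN]; last first.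
  apply: big1 => l neq_li; rewrite /Gblk (negPf neq_li).
  case: eqVneq => [eq_l|_]; last by rewrite trmx0 !mul0mx.
  by rewrite /= in eq_l; rewrite -eq_l ltn_ord in geSkN.
pose i' := Ordinal ltSkN.
have neq_i'i : i' != i by rewrite -val_eqE /= gtn_eqF.
rewrite (bigD1 i') //= /Gblk (negPf neq_i'i) /= eqxx [(- _)^T]linearN /=.
rewrite !mulNmx mulmxN opprK big1 ?addr0 // => l /andP[neq_li neq_li'].
rewrite (negPf neq_li) -[X in _ == X]/(val i') val_eqE (negPf neq_li').
by rewrite trmx0 !mul0mx.
Qed.

(** The [H] part is block diagonal, and block row [l] of [G] meets columns [l]
    and [l-1] only, so block row [k] of [G] alone contributes here. *)
Lemma bbt_cE k : (1 < k <= N)%N -> bbt_c A k = - (invmx (Q k) *m G k).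
Proof.
case: k => [//|[//|k]] /= ltSkN.
pose i := Ordinal (ltnW ltSkN); pose i' := Ordinal ltSkN.
have neq_i'i : i' != i by rewrite -val_eqE /= gtn_eqF.
rewrite /bbt_c /mxblk (insub_stage i) (insub_stage i') submxblock_system_mx.
rewrite sum_Hblk {1}/Hblk (negPf neq_i'i) mulmx0 add0r.
rewrite (bigD1 i') //= {1}/Gblk eqxx trmx1 mul1mx {1}/Gblk (negPf neq_i'i).
rewrite /= eqxx mulmxN big1 ?addr0 // => l neq_li'.
rewrite /Gblk (negPf neq_li'); case: (eqVneq l i) => [->|_].
  by rewrite /= ltn_eqF ?trmx0 ?mul0mx.
have -> : (l == i.+1 :> nat) = false by apply: negPf neq_li'.
by rewrite mulmx0.
Qed.

(** [zeta] lives in the first block, and the first block row of [G] is the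
    identity followed by zeros, so [x0] enters at stage 1 only. *)
Lemma cvblk_system_rhs k : (0 < k <= N)%N ->
  cvblk r k = (H k)^T *m invmx (R k) *m z k
              + (if k == 1%N then invmx (Q 1%N) *m x0 else 0).
Proof.
case: k => // k ltkN; pose i := Ordinal ltkN.
rewrite /cvblk (insub_stage i) submxcol_system_rhs sum_Hblk; congr (_ + _).
have N_gt0 : (0 < N)%N by exact: leq_ltn_trans (leq0n k) ltkN.
rewrite (bigD1 (Ordinal N_gt0)) //= big1 ?addr0; last first.
  by move=> l; rewrite -val_eqE /= => /negPf->; rewrite mulmx0.
rewrite /Gblk -val_eqE /= eq_sym eqSS.
by case: eqP => _; rewrite ?trmx1 ?mul1mx // trmx0 !mul0mx.
Qed.

End SystemBlocks.

(** * Equivalence of the two algorithms *)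

Lemma stage_ind (N : nat) (T : nat -> Prop) :
  T N ->
  (forall k, (0 < k < N)%N -> T k.+1 -> T k) ->
  forall k, (1 <= k <= N)%N -> T k.
Proof.
move=> TN Tstep k /andP[k_gt0 lekN]; rewrite -(subKn lekN).
have : (N - k < N)%N by rewrite ltn_subrL k_gt0 (leq_trans k_gt0).
elim: (N - k)%N => [|j IHj] ltjN; first by rewrite subn0.
apply: Tstep; first by rewrite subn_gt0 ltjN ltn_subrL (leq_trans _ ltjN).
by rewrite subnSK; [apply: IHj; apply: ltnW | apply: ltnW].
Qed.

Theorem theoremV1 (F : realFieldType) (N n : nat) (m p : nat -> nat)
    (G : nat -> 'M[F]_n) (H : forall k, 'M[F]_(m k, n))
    (Q : nat -> 'M[F]_n) (R : forall k, 'M[F]_(m k))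
    (C : forall k, 'M[F]_(n, p k))
    (z : forall k, 'cV[F]_(m k)) (x0 : 'cV[F]_n)
    (N_gt0 : (0 < N)%N)
    (Q_posdef : forall k, (1 <= k <= N)%N -> posdefmx (Q k))
    (R_posdef : forall k, (1 <= k <= N)%N -> posdefmx (R k))
    (Q_factor : forall k, (1 <= k <= N)%N -> Q k = C k *m (C k)^T) :
  let A := system_mx N G H Q R in
  let r := system_rhs N G H Q R z x0 in
  let d := bbt_d A in
  let s := bbt_s A r in
  let e := bbt_e A r in
  let P := mayne_P N G H R C in
  let phi := mayne_phi N G H R C z in
  let xhat := mayne_xhat N G H Q R C z x0 in
  [/\ (* every inverse taken by either algorithm exists *)
      forall k, (1 <= k <= N)%N ->
        d k \in unitmx /\ mayne_DeltaV C k (P k) \in unitmx,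
      forall k, (1 <= k <= N)%N -> d k = P k + invmx (Q k),
      forall k, (1 < k <= N)%N -> s k = - phi k,
      (* at k = 1 the right-hand side also carries the initial state *)
      s 1%N = - (phi 1%N - invmx (Q 1%N) *m x0)
    & forall k, (1 <= k <= N)%N -> e k = xhat k].
Proof.
move=> A r d s e P phi xhat.
have Q_unit k (lekN : (1 <= k <= N)%N) := posdefmx_unit (Q_posdef k lekN).
have R_unit k (lekN : (1 <= k <= N)%N) := posdefmx_unit (R_posdef k lekN).
have bE := bbt_bE G H Q_unit R_unit.
have cE := bbt_cE G H Q_unit R_unit.
have rE := cvblk_system_rhs G H z x0 Q_unit R_unit.
(* From here on only the blocks of the system are used; hiding its definition
   keeps unification from expanding the assembled matrices. *)
rewrite -/A in bE cE; rewrite -/r in rE; clearbody A r.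
have stageN : (1 <= N <= N)%N by rewrite N_gt0 leqnn.
have P_last : P N = (H N)^T *m invmx (R N) *m H N by exact: backrec_last.
pose K k := 1%:M - P k *m C k *m mayne_Delta C k (P k) *m (C k)^T.
have P_step k : (k < N)%N ->
    P k = (G k.+1)^T *m K k.+1 *m P k.+1 *m G k.+1
          + (H k)^T *m invmx (R k) *m H k.
  exact: backrec_step.
have phi_last : phi N = - ((H N)^T *m invmx (R N) *m z N).
  exact: backrec_last.
have phi_step k : (k < N)%N ->
    phi k = - ((H k)^T *m invmx (R k) *m z k) + (G k.+1)^T *m K k.+1 *m phi k.+1.
  exact: backrec_step.
have P_psd k : (1 <= k <= N)%N -> psdmx (P k).
  have HRH_psd l : (1 <= l <= N)%N -> psdmx ((H l)^T *m invmx (R l) *m H l).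
    by move=> /R_posdef/posdefmx_inv/posdefmx_psdmx/psdmx_congr.
  move: k; apply: stage_ind => [|k /andP[k_gt0 ltkN] IHk].
    by rewrite P_last; apply: HRH_psd.
  rewrite P_step //; apply: psdmxD (HRH_psd k _); last by rewrite k_gt0 ltnW.
  rewrite -(mulmxA _ (K _)); apply: psdmx_congr.
  exact: psdmx_mayne_factor_mulP (Q_posdef k.+1 ltkN) (Q_factor k.+1 ltkN) IHk.
have cT k : (1 < k <= N)%N -> (bbt_c A k)^T = - ((G k)^T *m invmx (Q k)).
  move=> /[dup] ltkN /andP[k_gt1 lekN]; rewrite cE // linearN /= trmx_mul trmx_inv.
  by case: (Q_posdef k) => [|-> //]; rewrite (ltnW k_gt1).
have dE k : (1 <= k <= N)%N -> d k = P k + invmx (Q k).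
  move: k; apply: stage_ind => [|k /andP[k_gt0 ltkN] IHk].
    by rewrite /d /bbt_d backrec_last bE // ltnn addr0 P_last.
  have ltSk : (1 < k.+1 <= N)%N by rewrite ltnS k_gt0.
  have lek : (1 <= k <= N)%N by rewrite k_gt0 ltnW.
  have -> : d k = bbt_b A k - (bbt_c A k.+1)^T *m invmx (d k.+1) *m bbt_c A k.+1.
    exact: backrec_step.
  rewrite (cT _ ltSk) (cE _ ltSk) (bE _ lek) ltkN IHk (P_step _ ltkN).
  rewrite -(mulmxA _ (K _)).
  rewrite [K _ *m _](mayne_factor_mulP (Q_posdef k.+1 ltkN) (Q_factor k.+1 ltkN)
                       (P_psd k.+1 ltkN)).
  rewrite !mulNmx mulmxN opprK mulmxBr mulmxBl !mulmxA.
  by rewrite -[LHS]addrA [LHS]addrC !addrA.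
have sE k : (1 <= k <= N)%N ->
    s k = - phi k + (if k == 1%N then invmx (Q 1%N) *m x0 else 0).
  move: k; apply: stage_ind => [|k /andP[k_gt0 ltkN] IHk].
    by rewrite /s /bbt_s backrec_last rE // phi_last opprK.
  have ltSk : (1 < k.+1 <= N)%N by rewrite ltnS k_gt0.
  have lek : (1 <= k <= N)%N by rewrite k_gt0 ltnW.
  have -> : s k = cvblk r k - (bbt_c A k.+1)^T *m invmx (d k.+1) *m s k.+1.
    exact: backrec_step.
  rewrite (cT _ ltSk) (rE _ lek) IHk (dE k.+1 ltkN) eqSS (gtn_eqF k_gt0) addr0.
  rewrite (phi_step _ ltkN).
  rewrite [K _](mayne_factorE (Q_posdef k.+1 ltkN) (Q_factor k.+1 ltkN)
                  (P_psd k.+1 ltkN)).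
  by rewrite opprD opprK mulmxN !mulNmx opprK !mulmxA addrAC.
split=> // [k lekN|k /andP[k_gt1 lekN]||].
- rewrite dE //; have PD := P_psd k lekN.
  split; apply: posdefmx_unit; last exact: posdefmx_mayne_DeltaV.
  exact: posdefmx_mayne_D (Q_posdef k lekN) PD.
- by rewrite sE ?(ltnW k_gt1) // gtn_eqF // addr0.
- by rewrite sE ?N_gt0 // eqxx opprB addrC.
(* The forward sweeps agree term by term: Mayne's carries the minus sign in
   front of the inverse, the elimination carries it in s and c. *)
elim=> [//|k IHk] leSkN; rewrite /e /xhat /=; case: eqP => [k0|/eqP k_neq0].
  rewrite -/d -/s -/P -/phi dE ?sE ?N_gt0 // eqxx.
  by rewrite -mulmxN opprB [- phi _ + _]addrC.
have k_gt0 : (0 < k)%N by rewrite lt0n.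
have ltSk : (1 < k.+1 <= N)%N by rewrite ltnS k_gt0.
rewrite -/d -/s -/e -/xhat (dE _ leSkN) (sE _ leSkN) eqSS (negPf k_neq0) addr0.
rewrite (cE _ ltSk) IHk; last by rewrite k_gt0 ltnW.
by rewrite mulNmx opprK -mulmxN opprB [- phi _ + _]addrC.
Qed.
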